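(* For every $L$ there exist positive constants $r$ and $M$, depending only on $L$, such that the following holds. Let $(X,d)$ be a metric space such that there is an $L$-Lipschitz retraction $\mathcal R\colon X(4)\to X(3)$ and such that the interval $[0,1]$ admits an $L$-bi-Lipschitz embedding into $X$. Then any two points $p,q\in X$ with $d(p,q)\le r$ can be connected by a curve in $X$ of length at most $M\,d(p,q)$.
   Context: For a metric space $(X,d)$ and a positive integer $n$, $X(n)=\{A\subset X\colon 1\le |A|\le n\}$, equipped with the Hausdorff metric $\Delta(A,B)=\max\left(\sup_{a\in A}\operatorname{dist}(a,B),\ \sup_{b\in B}\operatorname{dist}(b,A)\right)$; $X(3)\subset X(4)$. A retraction $\mathcal R\colon X(4)\to X(3)$ is a map whose restriction to $X(3)$ is the identity. A map $f\colon X\to Y$ of metric spaces is $L$-Lipschitz if $d_Y(f(x),f(x'))\le L\,d_X(x,x')$ for all $x,x'\in X$, and $L$-bi-Lipschitz if $L^{-1}d_X(x,x')\le d_Y(f(x),f(x'))\le L\,d_X(x,x')$ for all $x,x'\in X$. The interval $[0,1]$ carries the metric $|x-y|$. *)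

(* Defs.v *)
From HB Require Import structures.
From mathcomp Require Import all_boot all_order all_algebra.
From mathcomp Require Import all_classical all_reals all_analysis.

Set Implicit Arguments.
Unset Strict Implicit.
Unset Printing Implicit Defensive.

Import Order.TTheory GRing.Theory Num.Theory.
Import numFieldNormedType.Exports.

Local Open Scope classical_set_scope.
Local Open Scope card_scope.
Local Open Scope ring_scope.

Section Hausdorff.
Context {R : realType} {X : metricType R}.
Implicit Types (x y : X) (A B C : set X).

Definition set_dist x A : R := inf [set mdist x a | a in A].

(* The real [sup] and [inf] are 0 on unbounded or empty sets, so this is the
   Hausdorff distance only for nonempty bounded sets; it is used for nonempty
   finite ones. *)
Definition hausdorff_dist A B : R :=
  Num.max (sup [set set_dist a B | a in A]) (sup [set set_dist b A | b in B]).

Lemma set_dist_le x A a : A a -> set_dist x A <= mdist x a.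
Proof.
move=> Aa; apply: ge_inf; last by exists a.
by exists 0 => _ [b _ <-]; exact: mdist_ge0.
Qed.

Lemma set_dist_ge x A r :
  A !=set0 -> (forall a, A a -> r <= mdist x a) -> r <= set_dist x A.
Proof.
move=> [a Aa] rA; apply: lb_le_inf; first by exists (mdist x a), a.
by move=> _ [b Ab <-]; exact: rA.
Qed.

Lemma finite_has_ubound (T : Type) (f : T -> R) (A : set T) :
  finite_set A -> has_ubound [set f a | a in A].
Proof.
move=> /(finite_image f) /finite_seqP[s ->].
elim: s => [|r s [M HM]]; first by exists 0 => x /=; rewrite in_nil.
exists (Num.max r M) => x /=; rewrite inE => /orP[/eqP ->|xs].
  by rewrite le_max lexx.
by rewrite le_max HM ?orbT.
Qed.

Lemma set_dist_le_hausdorff A B a :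
  finite_set A -> A a -> set_dist a B <= hausdorff_dist A B.
Proof.
move=> fA Aa; rewrite /hausdorff_dist le_max; apply/orP; left.
by apply: ub_le_sup; [exact: finite_has_ubound|exists a].
Qed.

Lemma hausdorff_dist_le A B r : A !=set0 -> B !=set0 ->
  (forall a, A a -> set_dist a B <= r) ->
  (forall b, B b -> set_dist b A <= r) -> hausdorff_dist A B <= r.
Proof.
move=> [a Aa] [b Bb] HA HB; rewrite /hausdorff_dist ge_max.
apply/andP; split; apply: ge_sup.
- by exists (set_dist a B), a.
- by move=> _ [c Ac <-]; exact: HA.
- by exists (set_dist b A), b.
- by move=> _ [c Bc <-]; exact: HB.
Qed.

Lemma hausdorff_distC A B : hausdorff_dist A B = hausdorff_dist B A.
Proof. exact: maxC. Qed.

Lemma hausdorff_distxx A : finite_set A -> A !=set0 -> hausdorff_dist A A = 0.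
Proof.
move=> fA A0; apply/eqP; rewrite eq_le; apply/andP; split.
  by apply: hausdorff_dist_le => // a Aa; rewrite -(mdistxx a); exact: set_dist_le.
have [a Aa] := A0; apply: le_trans (set_dist_le_hausdorff A fA Aa).
by apply: set_dist_ge => // b _; exact: mdist_ge0.
Qed.

Lemma set_dist_eq0 x A : finite_set A -> A !=set0 -> set_dist x A <= 0 -> A x.
Proof.
move=> fA A0; apply: contraPP => nAx; apply/negP; rewrite -ltNge.
have [e e0 eA] : exists2 e : R, 0 < e & forall a, A a -> e <= mdist x a.
  have /finite_seqP[s As] := fA.
  have : forall a, a \in s -> a != x.
    by move=> a sa; apply/eqP => ax; apply: nAx; rewrite As /= -ax.
  rewrite As => {As}; elim: s => [|b s IHs] sx; first by exists 1.
  have [a sa|e e0 es] := IHs; first by apply: sx; rewrite inE sa orbT.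
  exists (Num.min (mdist x b) e).
    by rewrite lt_min e0 mdist_gt0 eq_sym sx// inE eqxx.
  move=> a /=; rewrite inE => /orP[/eqP ->|sa]; first by rewrite ge_min lexx.
  by rewrite ge_min es ?orbT.
exact: lt_le_trans (set_dist_ge A0 eA).
Qed.

Lemma hausdorff_dist_eq0 A B :
  finite_set A -> A !=set0 -> finite_set B -> B !=set0 ->
  hausdorff_dist A B = 0 -> A = B.
Proof.
move=> fA A0 fB B0 AB; apply/seteqP; split=> x.
  by move=> Ax; apply: set_dist_eq0; rewrite // -AB set_dist_le_hausdorff.
move=> Bx; apply: set_dist_eq0; rewrite // -AB hausdorff_distC.
exact: set_dist_le_hausdorff.
Qed.

Lemma hausdorff_dist_triangle B A C :
  finite_set A -> A !=set0 -> finite_set B -> B !=set0 ->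
  finite_set C -> C !=set0 ->
  hausdorff_dist A C <= hausdorff_dist A B + hausdorff_dist B C.
Proof.
have H A1 B1 C1 a : finite_set A1 -> finite_set B1 -> B1 !=set0 ->
    C1 !=set0 -> A1 a ->
    set_dist a C1 <= hausdorff_dist A1 B1 + hausdorff_dist B1 C1.
  move=> fA fB B0 C0 Aa.
  rewrite -lerBlDr; apply: le_trans (set_dist_le_hausdorff B1 fA Aa).
  apply: set_dist_ge => // b Bb; rewrite lerBlDr -lerBlDl.
  apply: le_trans (set_dist_le_hausdorff C1 fB Bb).
  apply: set_dist_ge => // c Cc; rewrite lerBlDl.
  by apply: le_trans (metric_triangle _ _ _); exact: set_dist_le.
move=> fA A0 fB B0 fC C0; apply: hausdorff_dist_le => // x Ax; first exact: H.
by rewrite addrC [X in X + _]hausdorff_distC [X in _ + X]hausdorff_distC; exact: H.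
Qed.

End Hausdorff.

(* The space X(n) of nonempty subsets of X with at most n points. *)
Record finsub (n : nat) (X : Type) := FinSub {
  finsub_set :> set X ;
  finsub_neq0 : finsub_set !=set0 ;
  finsub_card : finsub_set #<= `I_n }.

Lemma finsub_inj n X : injective (@finsub_set n X).
Proof.
move=> [A A0 An] [B B0 Bn] /= AB; move: A0 An; rewrite AB => A0 An.
by congr FinSub; exact: Prop_irrelevance.
Qed.

Lemma finsub_finite n X (A : finsub n X) : finite_set A.
Proof. by apply/finite_set_leP; exists n; exact: finsub_card. Qed.

HB.instance Definition _ n X := gen_eqMixin (finsub n X).
HB.instance Definition _ n X := gen_choiceMixin (finsub n X).

Section finsub_metric.
Context {R : realType} {X : metricType R} {n : nat}.

Let dist (A B : finsub n X) : R := hausdorff_dist A B.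

Let distxx A : dist A A = 0.
Proof. by apply: hausdorff_distxx; [exact: finsub_finite|exact: finsub_neq0]. Qed.

Let dist_positivity A B : dist A B = 0 -> A = B.
Proof.
move=> AB; apply: finsub_inj; apply: hausdorff_dist_eq0 AB;
  by [exact: finsub_finite|exact: finsub_neq0].
Qed.

Let dist_sym A B : dist A B = dist B A.
Proof. exact: hausdorff_distC. Qed.

Let dist_triangle B A C : dist A C <= dist A B + dist B C.
Proof.
by apply: hausdorff_dist_triangle; by [exact: finsub_finite|exact: finsub_neq0].
Qed.

HB.instance Definition _ := @isMetric.Build R (finsub n X) dist
  distxx dist_positivity dist_sym dist_triangle.

End finsub_metric.

Lemma finsub_mdistE (R : realType) (X : metricType R) n (A B : finsub n X) :
  mdist A B = hausdorff_dist A B.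
Proof. by []. Qed.

Lemma finsub_card_widen m n X (mn : (m <= n)%N) (A : finsub m X) :
  (A : set X) #<= `I_n.
Proof. by apply: card_le_trans (finsub_card A) _; rewrite card_le_II. Qed.

Definition finsub_widen m n X (mn : (m <= n)%N) (A : finsub m X) :
  finsub n X := FinSub (finsub_neq0 A) (finsub_card_widen mn A).

Definition finsub_retraction m n X (mn : (m <= n)%N)
    (r : finsub n X -> finsub m X) :=
  forall A : finsub m X, r (finsub_widen mn A) = A.

Section maps.
Context {R : realType} {X Y : metricType R}.

Definition lipschitz_map (L : R) (f : X -> Y) :=
  forall x x', mdist (f x) (f x') <= L * mdist x x'.

(* Meant for L <> 0: since 0^-1 = 0, the case L = 0 allows constant maps. *)
Definition bilipschitz_on (L : R) (A : set X) (f : X -> Y) :=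
  forall x x', A x -> A x' ->
    L^-1 * mdist x x' <= mdist (f x) (f x') <= L * mdist x x'.

End maps.

Section curves.
Context {R : realType} {X : metricType R}.

(* As for [itv_partition], [a :: s] lists the points of a partition of
   [a, b]. *)
Definition curve_variation (a b : R) (g : R -> X) (s : seq R) : R :=
  let G := g \o nth b (a :: s) in
  \sum_(0 <= i < size s) mdist (G i) (G i.+1).

Definition curve_length (a b : R) (g : R -> X) : \bar R :=
  ereal_sup [set (curve_variation a b g s)%:E | s in itv_partition a b].

Definition curve_from_to (g : R -> X) (p q : X) :=
  [/\ {within `[0, 1], continuous g}, g 0 = p & g 1 = q].

End curves.

(* Main.v *)
(* Let a be an endpoint of the embedded interval that is far from p, let b move
   along the interval starting at a, and look at the points of rho {p, q, a, b}
   near p. For b = a these are p and q, because {p, q, a} is fixed by rho. Once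
   d(a, b) is a large multiple of d(p, q), the three points of rho {p, q, a, b}
   approximate p, a and b separately, so only one of them is near p. This
   Lipschitz path of finite sets, run over a time O(d(p, q)), has Lipschitz
   selections starting at p and at q, which meet at the end. *)
Require Import Defs.
From HB Require Import structures.
From mathcomp Require Import all_boot all_order all_algebra.
From mathcomp Require Import all_classical all_reals all_analysis.
From mathcomp Require Import ring lra.

Import Order.TTheory GRing.Theory Num.Theory.
Import numFieldNormedType.Exports.

Local Open Scope classical_set_scope.
Local Open Scope ring_scope.

(** * Lipschitz selections of set-valued maps of time *)

Section selection.
Context {R : realType} {X : metricType R}.
Variables (D : set R) (K : R) (N : R -> set X).
Hypothesis step : forall s t x, D s -> D t -> s <= t -> N s x ->
  exists2 y, N t y & mdist x y <= K * (t - s).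

(** Points are chosen one time after another by [step]. As the times are sorted, the gaps between
    successive times add up, so the triangle inequality keeps the same constant [K]. *)
Lemma lipschitz_selection_seq (a : R) (s : seq R) (x : X) :
  D a -> (forall t, t \in s -> D t) -> path <=%R a s -> N a x ->
  exists2 u : R -> X, u a = x &
    forall t t', t \in a :: s -> t' \in a :: s -> t <= t' ->
      N t (u t) /\ mdist (u t) (u t') <= K * (t' - t).
Proof.
elim: s a x => [|b s IHs] a x Da Ds.
  move=> _ Nx; exists (fun=> x) => // t t'; rewrite !inE => /eqP-> /eqP-> _.
  by rewrite mdistxx subrr mulr0.
move=> /= /andP[ab bs] Nx.
have Db : D b by apply: Ds; rewrite mem_head.
have [y Ny xy] := step a b x Da Db ab Nx.
have [|u uy uN] := IHs b y Db _ bs Ny.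
  by move=> t ts; apply: Ds; rewrite inE ts orbT.
have ge_b t : t \in b :: s -> b <= t.
  rewrite inE => /predU1P[->//|]; move: t; apply/allP.
  exact: (order_path_min le_trans bs).
exists (fun t => if t == a then x else u t); first by rewrite eqxx.
move=> t t'; rewrite !(in_cons a).
have [-> _|ta /= tbs] := eqVneq t a; have [-> _|t'a /= tbs'] := eqVneq t' a.
- by rewrite mdistxx subrr mulr0.
- move=> _; split=> //; apply: le_trans (metric_triangle _ y _) _.
  have [_] := uN b t' (mem_head _ _) tbs' (ge_b _ tbs').
  by rewrite uy; move: xy; lra.
- move=> le_ta; have := le_trans ab (ge_b _ tbs).
  by move=> le_at; case/eqP: ta; apply/le_anti/andP.
- exact: uN.
Qed.

(* The selections on finite sets of times provided by
   [lipschitz_selection_seq] converge along an ultrafilter finer than the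
   filter of large finite sets: as N t is finite, their values at t are
   constant along it. *)
Lemma lipschitz_selection (a : R) (x : X) :
  (forall t, D t -> finite_set (N t)) ->
  D a -> (forall t, D t -> a <= t) -> N a x ->
  exists u : R -> X, [/\ u a = x, forall t, D t -> N t (u t) &
    forall t t', D t -> D t' -> t <= t' -> mdist (u t) (u t') <= K * (t' - t)].
Proof.
move=> finN Da aD Nx.
have /choice[v vP] : forall F : seq R, exists u : R -> X, u a = x /\
    forall t t', D t -> D t' -> t \in F -> t' \in F -> t <= t' ->
      N t (u t) /\ mdist (u t) (u t') <= K * (t' - t).
  move=> F; pose s := sort <=%R [seq t <- F | `[< D t >]].
  have sE t : (t \in s) = (`[< D t >] && (t \in F)).
    by rewrite mem_sort mem_filter.
  have [||u ua uN] := @lipschitz_selection_seq a s x Da _ _ Nx.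
  - by move=> t; rewrite sE => /andP[/asboolP].
  - rewrite path_min_sorted; first exact: sort_le_sorted.
    by apply/allP => t; rewrite sE => /andP[/asboolP/aD].
  - exists u; split=> // t t' Dt Dt' tF t'F.
    apply: uN; rewrite inE sE ?tF ?t'F andbT; apply/orP; right;
      exact/asboolP.
pose large : set_system (seq R) :=
  filter_from setT (fun s : seq R => [set F : seq R | {subset s <= F}]).
have large_proper : ProperFilter large.
  apply: filter_from_proper; last by move=> s _; exists s.
  apply: filter_fromT_filter; first by exists [::].
  move=> s t; exists (s ++ t) => F /= stF.
  by split=> z zs; apply: stF; rewrite mem_cat zs ?orbT.
have [G [GU largeG]] := ultraFilterLemma large_proper.
have in_large t : G [set F : seq R | t \in F].
  by apply: largeG; exists [:: t] => // F; apply; rewrite mem_head.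
have /choice[u uP] : forall t, exists y,
    D t -> N t y /\ G [set F : seq R | v F t = y].
  move=> t; have [Dt|nDt] := pselect (D t); last by exists x.
  have /finite_seqP[l lE] := finN t Dt.
  have : G [set F : seq R | v F t \in l].
    apply: filterS (in_large t) => F tF.
    have [Nv _] := (vP F).2 t t Dt Dt tF tF (lexx t).
    by rewrite lE in Nv.
  have : {subset l <= N t} by move=> z zl; rewrite inE lE.
  (* The candidate values of [v F t] are discarded one by one: [G] contains the set where the value
     is [z] or its complement. The list cannot run out, since [G] does not contain the empty set. *)
  elim: l {lE} => [|z l IHl] lN Gl; first by have [] := filter_ex Gl.
  have [Gz|Gnz] := in_ultra_setVsetC [set F : seq R | v F t = z] GU.
    by exists z => _; split=> //; apply/set_mem/lN; rewrite mem_head.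
  apply: IHl => [w wl|]; first by apply: lN; rewrite inE wl orbT.
  by apply: filterS (filterI Gl Gnz) => F []/=; rewrite inE => /predU1P[].
exists u; split=> [|t Dt|t t' Dt Dt' tt'].
- have [_ Ga] := uP a Da; have [F /= <-] := filter_ex Ga.
  exact: (vP F).1.
- exact: (uP t Dt).1.
- have [[_ Gt] [_ Gt']] := (uP t Dt, uP t' Dt').
  (* A single [F] realizes both limit values and contains both times, so its Lipschitz bound passes
     to [u]. *)
  have [F /= [[vt vt'] [tF t'F]]] :=
    filter_ex (filterI (filterI Gt Gt') (filterI (in_large t) (in_large t'))).
  by rewrite -vt -vt'; exact: ((vP F).2 t t' Dt Dt' tF t'F tt').2.
Qed.

End selection.

(** * Lipschitz paths: continuity, length and gluing *)

Section lipschitz_curves.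
Context {R : realType} {X : metricType R}.
Implicit Types (K : R) (g u v : R -> X).

Definition lipschitz_path K u := forall s t, 0 <= s -> s <= t -> t <= 1 ->
  mdist (u s) (u t) <= K * (t - s).

Lemma lipschitz_path_continuous K u :
  lipschitz_path K u -> {within `[0, 1], continuous u}.
Proof.
move=> uK; apply/subspace_continuousP => x /=.
rewrite in_itv /= => /andP[x0 x1].
apply/cvg_ballP => e e0; rewrite near_withinE.
(* [K] may be 0, so [e] is divided by a larger, positive constant. *)
have K1 : 0 < `|K| + 1 by rewrite ltr_wpDl.
near=> y; rewrite /= in_itv /= => /andP[y0 y1].
rewrite ballEmdist /=.
have : `|x - y| < e / (`|K| + 1).
  by near: y; apply: nbhsx_ballx; rewrite divr_gt0.
rewrite ltr_pdivlMr // => xy.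
apply: le_lt_trans xy.
have leK : K <= `|K| + 1 by rewrite (le_trans (ler_norm K))// lerDl.
rewrite mulrC; have [xy|/ltW yx] := leP x y.
  rewrite distrC (@ger0_norm _ (y - x)) ?subr_ge0 //.
  apply: le_trans (uK _ _ x0 xy y1) _.
  by rewrite ler_wpM2r ?subr_ge0.
rewrite (@ger0_norm _ (x - y)) ?subr_ge0 // metric_sym.
apply: le_trans (uK _ _ y0 yx x1) _.
by rewrite ler_wpM2r ?subr_ge0.
Unshelve. all: by end_near. Qed.

Lemma lipschitz_path_length K u :
  lipschitz_path K u -> (curve_length 0 1 u <= K%:E)%E.
Proof.
move=> uK; apply: ge_ereal_sup => _ [s [+ /eqP s1] <-]; rewrite lee_fin.
(* The induction moves the starting point [a]; [b] is only the default of [nth] and is never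
   reached. *)
suff H (a b : R) : 0 <= a -> path <%R a s -> last a s <= 1 ->
    curve_variation a b u s <= K * (last a s - a).
  by move=> s0; have := H 0 1 (lexx _) s0; rewrite s1 subr0 mulr1; apply.
rewrite /curve_variation /=.
elim: s a {s1} => [|c s IHs] a a0 /=.
  by move=> _ _; rewrite big_geq // subrr mulr0.
move=> /andP[ac cs] s1; rewrite big_nat_recl //=.
have c0 : 0 <= c by rewrite (le_trans a0) ?ltW.
have cl : c <= last c s.
  have := order_path_min lt_trans cs => /allP cs'.
  have := mem_last c s; rewrite inE => /predU1P[->//|/cs' /ltW//].
have := IHs c c0 cs s1; have := uK a c a0 (ltW ac) (le_trans cl s1).
lra.
Qed.

(** The curve runs along [u] and then back along [v], each at double speed, and so joins [u 0] to
    [v 0]. *)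
Lemma lipschitz_path_glue K u v :
  lipschitz_path K u -> lipschitz_path K v -> u 1 = v 1 ->
  lipschitz_path (2 * K)
    (fun t => if t <= 2^-1 then u (2 * t) else v (2 * (1 - t))).
Proof.
move=> uK vK uv s t s0 st t1.
have [s2|s2] := leP s 2^-1; have [t2|t2] := leP t 2^-1.
- have := uK (2 * s) (2 * t); lra.
- apply: le_trans (metric_triangle _ (u 1) _) _.
  have := uK (2 * s) 1; have := vK (2 * (1 - t)) 1.
  rewrite uv (metric_sym (v 1)); lra.
- lra.
- rewrite metric_sym; have := vK (2 * (1 - t)) (2 * (1 - s)); lra.
Qed.

End lipschitz_curves.

Lemma regular_mdistE (R : realType) (x y : R^o) : mdist x y = `|y - x|.
Proof. by []. Qed.

(** * Points, distances and cardinality in X(n) *)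

Section finite_subsets.
Context {R : realType} {X : metricType R}.

Lemma set_dist_attained (x : X) (A : set X) : finite_set A -> A !=set0 ->
  exists2 a, A a & mdist x a <= set_dist x A.
Proof.
move=> fA A0.
have [a Aa aA] : exists2 a, A a & forall b, A b -> mdist x a <= mdist x b.
  have [s AE] := (finite_seqP A).1 fA; case: A0; rewrite AE => a0 /= a0s.
  elim: s {fA AE A} a0 a0s => // b s IHs a0 _.
  case: s IHs => [_|c s IHs].
    by exists b => [|z]; rewrite /= inE // => /eqP->.
  have [a as_ amin] := IHs c (mem_head _ _).
  have [ab|/ltW ba] := leP (mdist x a) (mdist x b).
    by exists a => [|z]; rewrite /= inE ?as_ ?orbT // => /predU1P[->//|/amin].
  exists b => [|z]; rewrite /= inE ?eqxx // => /predU1P[->//|/amin].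
  exact: le_trans.
by exists a => //; exact: set_dist_ge.
Qed.

Variable n : nat.
Implicit Types A B : finsub n X.

Lemma finsub_near A B x : (A : set X) x ->
  exists2 y, (B : set X) y & mdist x y <= mdist A B.
Proof.
move=> Ax.
have [y By yB] := set_dist_attained x _ (finsub_finite B) (finsub_neq0 B).
exists y => //; apply: le_trans yB _; rewrite finsub_mdistE.
by apply: set_dist_le_hausdorff => //; exact: finsub_finite.
Qed.

Lemma finsub_mdist_le A B (r : R) :
  (forall x, (A : set X) x -> exists2 y, (B : set X) y & mdist x y <= r) ->
  (forall y, (B : set X) y -> exists2 x, (A : set X) x & mdist x y <= r) ->
  mdist A B <= r.
Proof.
move=> AB BA; rewrite finsub_mdistE.
apply: hausdorff_dist_le; [exact: finsub_neq0|exact: finsub_neq0|..].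
  by move=> x /AB[y By]; apply: le_trans; exact: set_dist_le.
move=> y /BA[x Ax]; apply: le_trans; rewrite metric_sym; exact: set_dist_le.
Qed.

(** [nth] embeds [I_(size s)] into [A]. This serves to rule out four distinct points in a member of
    X(3). *)
Lemma finsub_size A (s : seq X) :
  uniq s -> (forall x, x \in s -> (A : set X) x) -> (size s <= n)%N.
Proof.
case: s => // x0 s us sA; set s' := x0 :: s in us sA *.
rewrite -card_le_II.
have inj : {in `I_(size s') &, injective (nth x0 s')}.
  move=> i j; rewrite !inE /= => is_ js_ /eqP.
  by rewrite nth_uniq // => /eqP.
rewrite -(card_le_eql (inj_card_eq inj)).
apply: card_le_trans (finsub_card A); apply: subset_card_le => _ [i /= is_ <-].
exact/sA/mem_nth.
Qed.

End finite_subsets.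

Section finite_sequences.
Context {R : realType} {X : metricType R}.
Variables (x : X) (s : seq X).

Lemma seq_finsub_neq0 : [set` x :: s] !=set0.
Proof. by exists x => /=; rewrite mem_head. Qed.

Lemma seq_finsub_card : ([set` x :: s] #<= `I_(size s).+1)%card.
Proof.
have -> : [set` x :: s] = nth x (x :: s) @` `I_(size s).+1.
  apply/seteqP; split=> [y /= ys|_ [i /= i_s <-]]; last exact: mem_nth.
  by exists (index y (x :: s)); [move: ys; rewrite -index_mem|exact: nth_index].
exact: card_image_le.
Qed.

(** Repetitions in the list are allowed, so the list determines a point of X(n) even when some
    entries coincide. *)
Definition seq_finsub : finsub (size s).+1 X :=
  FinSub seq_finsub_neq0 seq_finsub_card.

End finite_sequences.

(** * From the retraction to a Lipschitz path between two points *)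

Section retraction.
Context {R : realType} {X : metricType R}.
Variables (L : R) (rho : finsub 4 X -> finsub 3 X).
Hypotheses (rhoK : finsub_retraction (leqnSn 3) rho)
  (rhoL : lipschitz_map L rho).

(** The retraction displaces the relevant sets by at most [L * mdist p q], and its values move by at
    most [L * K] in unit time. The first strict bound therefore separates the approximants of [b 0]
    and [b 1]; the second leaves around [p] a gap that no point can cross in that time. *)
Lemma retraction_lipschitz_path (p q : X) (b : R -> X) (K : R) :
  1 <= L -> lipschitz_path K b ->
  2 * (L * mdist p q) < mdist (b 0) (b 1) ->
  (forall t, 0 <= t <= 1 -> 2 * (L * mdist p q) + L * K < mdist p (b t)) ->
  exists g, [/\ lipschitz_path (2 * (L * K)) g, g 0 = p & g 1 = q].
Proof.
move=> L1 bK bab pb.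
have L0 : 0 <= L by rewrite (le_trans ler01).
have K0 : 0 <= K.
  have := bK 0 1 (lexx _) ler01 (lexx _).
  by rewrite subr0 mulr1; apply: le_trans; exact: mdist_ge0.
set e := L * mdist p q in bab pb.
have e_ge0 : 0 <= e by rewrite mulr_ge0 ?mdist_ge0.
have LK0 : 0 <= L * K by rewrite mulr_ge0.
pose A t : finsub 4 X := seq_finsub p [:: q; b 0; b t].
pose T t : finsub 3 X := seq_finsub p [:: b 0; b t].
pose B t := rho (A t).
pose N t := [set x | (B t : set X) x /\ mdist p x <= e].
(* [T t] is [A t] without [q], for which [p] is a substitute. As [rho] fixes [T t], this puts [B t]
   within [e] of [T t]. *)
have AT t : mdist (A t) (finsub_widen (leqnSn 3) (T t)) <= mdist p q.
  apply: finsub_mdist_le => x /=; rewrite !inE.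
    have [->|xq] := eqVneq x q => /= xA.
      by exists p; rewrite /= ?inE ?eqxx // metric_sym.
    by exists x; rewrite /= ?inE // mdistxx mdist_ge0.
  move=> xT; exists x; last by rewrite mdistxx mdist_ge0.
  by rewrite /= !inE; case/or3P: xT => ->; rewrite ?orbT.
have BT t : mdist (B t) (T t) <= e.
  by rewrite -(rhoK (T t)); apply: le_trans (rhoL _ _) _; rewrite ler_wpM2l.
have BB s t : 0 <= s -> s <= t -> t <= 1 ->
    mdist (B s) (B t) <= L * K * (t - s).
  move=> s0 st t1; apply: le_trans (rhoL _ _) _.
  rewrite -mulrA ler_wpM2l //.
  have bst := bK s t s0 st t1.
  have Kst : 0 <= K * (t - s) by apply: le_trans bst; exact: mdist_ge0.
  apply: finsub_mdist_le => x /=; rewrite !inE => /or4P[]/eqP->;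
    solve [ by exists p; rewrite /= ?inE ?eqxx // mdistxx
          | by exists q; rewrite /= ?inE ?eqxx ?orbT // mdistxx
          | by exists (b 0); rewrite /= ?inE ?eqxx ?orbT // mdistxx
          | by exists (b t); rewrite /= ?inE ?eqxx ?orbT
          | by exists (b s); rewrite /= ?inE ?eqxx ?orbT ].
(* A point of [B t] is within [e] of [p], [b 0] or [b t]; in the last two cases [pb] makes it far
   from [p]. *)
have far t : 0 <= t <= 1 -> forall x, (B t : set X) x ->
    N t x \/ e + L * K < mdist p x.
  move=> t01 x Bx; have [y Ty xy] := finsub_near _ (B t) (T t) _ Bx.
  have {}xy := le_trans xy (BT t).
  have far_b s : 0 <= s <= 1 -> y = b s -> e + L * K < mdist p x.
    move=> /pb pbs ys; rewrite ys in xy; have := metric_triangle p x (b s).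
    by move: pbs xy; lra.
  move: Ty; rewrite /= !inE => /or3P[]/eqP yE.
  - by left; split=> //; rewrite metric_sym -yE.
  - by right; apply: (far_b 0) => //; rewrite lexx ler01.
  - by right; apply: (far_b t).
(* A displacement of at most [L * K] cannot cross the gap given by [far], so the point followed
   stays in [N]. *)
have step s t x : 0 <= s <= 1 -> 0 <= t <= 1 -> s <= t -> N s x ->
    exists2 y, N t y & mdist x y <= L * K * (t - s).
  move=> /andP[s0 s1] t01 st [Bx px]; have /andP[t0 t1] := t01.
  have [y By xy] := finsub_near _ (B s) (B t) _ Bx.
  have {}xy := le_trans xy (BB s t s0 st t1).
  exists y => //; have [//|py] := far t t01 y By.
  have := metric_triangle p x y; move: px xy py.
  have : L * K * (t - s) <= L * K by rewrite ler_piMr //; lra.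
  lra.
have finN t : 0 <= t <= 1 -> finite_set (N t).
  move=> _; apply: sub_finite_set (finsub_finite (B t)); exact: subIsetl.
have B0 : (B 0 : set X) = [set` [:: p; q; b 0]].
  have -> : B 0 = seq_finsub p [:: q; b 0]; last by [].
  rewrite -(rhoK (seq_finsub p [:: q; b 0])); congr (rho _).
  apply: finsub_inj; apply/seteqP; split=> x /=; rewrite !inE.
    by case/or4P => ->; rewrite ?orbT.
  by case/or3P => ->; rewrite ?orbT.
have N0p : N 0 p by rewrite /N /= B0 mdistxx /= !inE eqxx.
have N0q : N 0 q.
  rewrite /N /= B0 /= !inE eqxx orbT; split=> //.
  (* By [1 <= L], the distance from [p] to [q] is at most [e]. *)
  by rewrite ler_peMl ?mdist_ge0.
have t_ge0 (t : R) : 0 <= t <= 1 -> 0 <= t by case/andP.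
have I0 : 0 <= (0 : R) <= 1 by rewrite lexx ler01.
have I1 : 0 <= (1 : R) <= 1 by rewrite lexx ler01.
have [u [u0 uN uK]] := @lipschitz_selection R X (fun t => 0 <= t <= 1) _ N step
  0 p finN I0 t_ge0 N0p.
have [v [v0 vN vK]] := @lipschitz_selection R X (fun t => 0 <= t <= 1) _ N step
  0 q finN I0 t_ge0 N0q.
(* Distinct [x] and [y], together with approximants of [b 0] and [b 1], would be four distinct
   points of [B 1]. *)
have N1 x y : N 1 x -> N 1 y -> x = y.
  move=> [Bx px] [By py]; apply/eqP; rewrite -[_ == _]negbK; apply/negP => xy.
  have near_b s : b s \in [:: b 0; b 1] -> 0 <= s <= 1 ->
      exists2 z, (B 1 : set X) z & mdist (b s) z <= e /\ e < mdist p z.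
    move=> bs s01; have Ts : (T 1 : set X) (b s) by rewrite /= inE bs orbT.
    have [z Bz sz] := finsub_near _ (T 1) (B 1) _ Ts.
    have {}sz : mdist (b s) z <= e.
      by apply: le_trans (BT 1); rewrite [leRHS]metric_sym.
    exists z => //; split=> //; have := metric_triangle p z (b s).
    by have := pb s s01; rewrite (metric_sym z); lra.
  have [z Bz [bz pz]] := near_b 0 (mem_head _ _) I0.
  have [|w Bw [bw pw]] := near_b 1 _ I1; first by rewrite !inE eqxx orbT.
  have neq a c : mdist p a <= e -> e < mdist p c -> a != c.
    by move=> pa pc; apply: contraTneq pc => <-; rewrite -leNgt.
  have zw : z != w.
    apply: contraTneq bab => zw; rewrite -leNgt.
    have := metric_triangle (b 0) z (b 1).
    by rewrite (metric_sym z) {2}zw; lra.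
  have : (size [:: x; y; z; w] <= 3)%N.
    apply: (finsub_size _ (B 1)) => [|a].
      by rewrite /= !inE !negb_or xy zw !neq.
    by rewrite !inE => /or4P[]/eqP->.
  by [].
have uv : u 1 = v 1 by apply: N1; [exact: uN|exact: vN].
have path (w : R -> X) : (forall s t, 0 <= s <= 1 -> 0 <= t <= 1 -> s <= t ->
    mdist (w s) (w t) <= L * K * (t - s)) -> lipschitz_path (L * K) w.
  move=> wK s t s0 st t1; apply: wK => //; apply/andP; split=> //.
    exact: le_trans t1.
  exact: le_trans st.
have := lipschitz_path_glue _ _ _ (path _ uK) (path _ vK) uv.
set g := (g in lipschitz_path _ g) => gK; exists g; split=> //; rewrite /g.
  by rewrite mulr0 invr_ge0 ler0n.
by rewrite subrr mulr0 v0 ifN // -ltNge; lra.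
Qed.

End retraction.

(** * Degenerate cases, choice of constants and the theorem *)

Lemma lipschitz_path_curve (R : realType) (X : metricType R) (K M : R)
    (p q : X) (g : R -> X) :
  lipschitz_path K g -> g 0 = p -> g 1 = q -> K <= M ->
  curve_from_to g p q /\ (curve_length 0 1 g <= M%:E)%E.
Proof.
move=> gK g0 g1 KM; split.
  by split=> //; exact: lipschitz_path_continuous gK.
by apply: le_trans (lipschitz_path_length _ _ gK) _; rewrite lee_fin.
Qed.

(** [S x] is the singleton of [x]. As [rho] fixes singletons, a constant [L < 1] forces their
    distances to vanish. *)
Lemma contracting_retraction_eq (R : realType) (X : metricType R) (L : R)
    (rho : finsub 4 X -> finsub 3 X) (p q : X) :
  L < 1 -> finsub_retraction (leqnSn 3) rho -> lipschitz_map L rho -> p = q.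
Proof.
move=> L1 rhoK rhoL; pose S x : finsub 3 X := seq_finsub x [:: x; x].
have : mdist (S p) (S q) <= L * mdist (S p) (S q).
  by rewrite -{1}(rhoK (S p)) -{1}(rhoK (S q)); exact: rhoL.
have := mdist_ge0 (S p) (S q) => SS0 SSL.
have /mdist_positivity E : mdist (S p) (S q) = 0.
  by apply/eqP; rewrite eq_le SS0 andbT; nra.
have : (S q : set X) p by rewrite -E /= mem_head.
by rewrite /= !inE !orbb => /eqP.
Qed.

(* Reversing the interval if necessary, the embedded interval starts far from
   p. *)
Lemma bilipschitz_far_endpoint (R : realType) (X : metricType R) (L : R)
    (f : R^o -> X) (p : X) :
  bilipschitz_on L (`[0 : R, 1] : set R^o) f ->
  exists2 h : R -> X, L^-1 / 2 <= mdist p (h 0) &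
    forall s t, 0 <= s -> s <= t -> t <= 1 ->
      L^-1 * (t - s) <= mdist (h s) (h t) <= L * (t - s).
Proof.
move=> fL.
have {}fL (s t : R) : 0 <= s -> s <= t -> t <= 1 ->
    L^-1 * (t - s) <= mdist (f s) (f t) <= L * (t - s).
  move=> s0 st t1; have <- : mdist (s : R^o) t = t - s.
    by rewrite regular_mdistE ger0_norm ?subr_ge0.
  by apply: fL; rewrite /= in_itv /= ?s0 ?t1 ?(le_trans st) // (le_trans s0).
have [f0|f0] := leP (L^-1 / 2) (mdist p (f 0)); first by exists f.
(* [f 0] and [f 1] are at least [L^-1] apart, so [f 1] is far from [p] when [f 0] is not. *)
exists (fun t => f (1 - t)) => [|s t s0 st t1].
  have /andP[+ _] := fL 0 1 (lexx _) ler01 (lexx _).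
  have := metric_triangle (f 0) p (f 1); rewrite (metric_sym (f 0) p) !subr0.
  by move: f0; lra.
rewrite metric_sym (_ : t - s = (1 - s) - (1 - t)); last by ring.
by apply: fL; lra.
Qed.

Theorem theorem5p1 (R : realType) (L : R) :
  exists r M : R, 0 < r /\ 0 < M /\
    forall X : metricType R,
      (exists rho : finsub 4 X -> finsub 3 X,
         finsub_retraction (leqnSn 3) rho /\ lipschitz_map L rho) ->
      (exists f : R^o -> X, bilipschitz_on L (`[0 : R, 1] : set R^o) f) ->
      forall p q : X, mdist p q <= r ->
        exists g : R -> X,
          curve_from_to g p q /\ (curve_length 0 1 g <= (M * mdist p q)%:E)%E.
Proof.
have const (X : metricType R) (p : X) (M : R) : exists g : R -> X,
    curve_from_to g p p /\ (curve_length 0 1 g <= (M * mdist p p)%:E)%E.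
  exists (fun=> p); apply: (@lipschitz_path_curve _ _ 0) => //.
    by move=> s t *; rewrite mdistxx mul0r.
  by rewrite mdistxx mulr0.
have [L1|L1] := ltP L 1.
  exists 1, 1; rewrite ltr01; do 2!split=> //.
  move=> X [rho [rhoK rhoL]] _ p q _.
  by rewrite (contracting_retraction_eq _ _ _ _ p q L1 rhoK rhoL); exact: const.
have L0 : 0 < L by rewrite (lt_le_trans ltr01).
(* The first constant gives [L ^+ 4 * d <= L^-1 / 20]; the second is [2 * (L * (L * sigma)) / d] for
   the [sigma] below. *)
exists (20 * L ^+ 5)^-1, (6 * L ^+ 4).
rewrite invr_gt0 !mulr_gt0 ?exprn_gt0 ?ltr0n //; do 2!split=> //.
move=> X [rho [rhoK rhoL]] [f fL] p q pq.
have [<-|p_neq_q] := eqVneq p q; first exact: const.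
have d0 : 0 < mdist p q by rewrite mdist_gt0.
set d := mdist p q in pq d0 *.
have [h ph hL] := bilipschitz_far_endpoint _ _ _ _ p fL.
set i := L^-1 in ph hL.
have i0 : 0 < i by rewrite invr_gt0.
have i1 : i <= 1 by rewrite invf_le1.
have L4 : L ^+ 4 * d <= i / 20.
  have L4d : 0 < L ^+ 4 by rewrite exprn_gt0.
  rewrite mulrC -ler_pdivlMr //; apply: le_trans pq _.
  by rewrite le_eqVlt; apply/orP; left; apply/eqP; rewrite /i; field; lra.
have leL4 n : (n <= 4)%N -> L ^+ n * d <= L ^+ 4 * d.
  by move=> n4; rewrite ler_wpM2r ?(ltW d0) // ler_weXn2l.
have L2 := leL4 2%N isT; have L3 := leL4 3%N isT; have L1d := leL4 1%N isT.
rewrite expr1 in L1d.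
(* Only the initial piece of length [sigma] of the interval is used. Its ends are at least
   [L^-1 * sigma = 3 * (L * d)] apart in [X], more than the required [2 * (L * d)]. *)
pose sigma := 3 * (L ^+ 2 * d).
have sigma0 : 0 < sigma by rewrite !mulr_gt0 ?exprn_gt0 ?ltr0n.
have sigma1 : sigma <= 1 by rewrite /sigma; lra.
have LsE : L * sigma = 3 * (L ^+ 3 * d) by rewrite /sigma; ring.
have bound s t : 0 <= s -> s <= t -> t <= 1 ->
    i * sigma * (t - s) <= mdist (h (sigma * s)) (h (sigma * t)) <=
    L * sigma * (t - s).
  move=> s0 st t1; rewrite -(mulrA i) -(mulrA L) mulrBr; apply: hL.
  - by rewrite mulr_ge0 // ltW.
  - by rewrite ler_pM2l.
  - by rewrite (le_trans _ sigma1) // ler_piMr // ltW.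
have [|||g [gK g0 g1]] := retraction_lipschitz_path _ _ rhoK rhoL p q
    (fun t => h (sigma * t)) (L * sigma) L1.
- by move=> s t s0 st t1; have /andP[] := bound s t s0 st t1.
- have /andP[+ _] := bound 0 1 (lexx _) ler01 (lexx _); apply: lt_le_trans.
  rewrite subr0 mulr1 -/d (_ : i * sigma = 3 * (L * d)).
    by rewrite ltr_pM2r ?mulr_gt0 // ltr_nat.
  by rewrite /i /sigma; field; rewrite gt_eqF.
(* The start is at least [i / 2] from [p]. The drift [3 * (L ^+ 3 * d)] and the required
   [2 * (L * d) + 3 * (L ^+ 4 * d)] add up to at most [8 * (i / 20)], which is less. *)
- move=> t /andP[t0 t1]; have /andP[_] := bound 0 t (lexx _) t0 t1.
  have : L * sigma * (t - 0) <= L * sigma.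
    by rewrite subr0 ler_piMr // mulr_ge0 // ltW.
  have := metric_triangle p (h (sigma * t)) (h 0).
  rewrite mulr0 (metric_sym (h 0)) -/d LsE.
  have -> : L * (3 * (L ^+ 3 * d)) = 3 * (L ^+ 4 * d) by ring.
  by move: ph; lra.
exists g; apply: (lipschitz_path_curve _ _ _ _ _ _ _ gK) => //.
by rewrite LsE le_eqVlt; apply/orP; left; apply/eqP; ring.
Qed.
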